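(* Let $\{x,x_1\}$ be a Mannheim $D$-pair of type 1 in Minkowski 3-space $E_1^3$ ($x$ a Mannheim $D$-curve and $x_1$ a Mannheim partner $D$-curve of $x$), with $x(s)$ lying on the oriented surface $S$, $x_1(s_1)$ lying on the oriented surface $S_1$, and $x=x_1+\lambda n_1$ at corresponding points, where $\lambda$ is a nonzero constant. Write a dot for the derivative with respect to $s_1$. Then the geodesic curvature $k_{g_1}$ of $x_1$ is related to the geodesic curvature $k_g$, normal curvature $k_n$ and geodesic torsion $\tau_g$ of $x$ as follows. (i) If $x$ is a geodesic curve ($k_g=0$), then $$k_{g_1}=k_n\left(1-\lambda^2\tau_g^2\right)\left(\frac{ds}{ds_1}\right)^3-\lambda\dot\tau_g\left(\frac{ds}{ds_1}\right)^2 .$$ (ii) If $x$ is an asymptotic line ($k_n=0$), then $$k_{g_1}=\left[-\lambda\dot\tau_g(1+\lambda k_g)+\lambda^2\tau_g\dot k_g\right]\left(\frac{ds}{ds_1}\right)^2 .$$ (iii) If $x$ is a principal line ($\tau_g=0$), then $$k_{g_1}=k_n(1+\lambda k_g)^2\left(\frac{ds}{ds_1}\right)^3 .$$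
   Context: $E_1^3$ is $\mathbb{R}^3$ with the metric $\langle u,v\rangle=-u_1v_1+u_2v_2+u_3v_3$ and the Lorentzian vector product $u\times v=(u_2v_3-u_3v_2,\;u_1v_3-u_3v_1,\;u_2v_1-u_1v_2)$. All curves and surfaces are smooth. A surface is timelike (spacelike) if its normal vector is spacelike (timelike). Type 1 means: $S$ is a spacelike surface and $x(s)$ is a spacelike curve on it; $S_1$ is a timelike surface and $x_1(s_1)$ is a spacelike curve on it; $s$ and $s_1$ are arc-length parameters. Darboux frames. $\{T,g,n\}$ is the Darboux frame of $x$: $T$ is the unit tangent, $n$ the unit normal of $S$, $g=n\times T$; here $\langle T,T\rangle=\langle g,g\rangle=1$, $\langle n,n\rangle=-1$. The geodesic curvature $k_g$, normal curvature $k_n$ and geodesic torsion $\tau_g$ of $x$ are defined by $$\frac{dT}{ds}=k_g g+k_n n,\quad \frac{dg}{ds}=-k_gT+\tau_g n,\quad \frac{dn}{ds}=k_nT+\tau_g g.$$ $\{T_1,g_1,n_1\}$ is the Darboux frame of $x_1$ on $S_1$: $T_1$ is the unit tangent, $n_1$ the unit normal of $S_1$, $g_1=n_1\times T_1$; here $\langle T_1,T_1\rangle=1$, $\langle g_1,g_1\rangle=-1$, $\langle n_1,n_1\rangle=1$. The geodesic curvature $k_{g_1}$, normal curvature $k_{n_1}$ and geodesic torsion $\tau_{g_1}$ of $x_1$ are defined by $$\frac{dT_1}{ds_1}=k_{g_1}g_1-k_{n_1}n_1,\quad \frac{dg_1}{ds_1}=k_{g_1}T_1+\tau_{g_1}n_1,\quad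 \frac{dn_1}{ds_1}=k_{n_1}T_1+\tau_{g_1}g_1.$$ Mannheim $D$-pair. $\{x,x_1\}$ is a Mannheim $D$-pair if there is a smooth regular correspondence $s=s(s_1)$ between the points of the curves such that at corresponding points the frame vector $g$ of $x$ coincides with the frame vector $n_1$ of $x_1$, i.e. $g=n_1$ and $x(s(s_1))=x_1(s_1)+\lambda n_1(s_1)$ with $\lambda$ a nonzero constant. The functions $k_g,k_n,\tau_g$ are regarded as functions of $s_1$ through $s=s(s_1)$. *)

(* Defs.v *)
From HB Require Import structures.
From mathcomp Require Import all_boot all_order all_algebra.
From mathcomp Require Import all_classical all_reals all_analysis.

Set Implicit Arguments.
Unset Strict Implicit.
Unset Printing Implicit Defensive.

Import Order.TTheory GRing.Theory Num.Theory.
Import numFieldNormedType.Exports.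

Local Open Scope ring_scope.
Local Open Scope classical_set_scope.

(* Coordinates u_1, u_2, u_3 of a vector are u 0 0, u 0 1, u 0 2. *)
Notation E13 R := 'rV[R]_3.

Definition ldot (R : realType) (u v : E13 R) : R :=
  - (u 0 0 * v 0 0) + u 0 1 * v 0 1 + u 0 2 * v 0 2.

Definition lcross (R : realType) (u v : E13 R) : E13 R :=
  \row_(i < 3)
    [:: u 0 1 * v 0 2 - u 0 2 * v 0 1;
        u 0 0 * v 0 2 - u 0 2 * v 0 0;
        u 0 1 * v 0 0 - u 0 0 * v 0 1]`_i.

Definition spacelike (R : realType) (u : E13 R) : Prop := 0 < ldot u u \/ u = 0.

Definition timelike (R : realType) (u : E13 R) : Prop := ldot u u < 0.

Definition lunit (R : realType) (u : E13 R) : Prop := `|ldot u u| = 1.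

(* Differentiability class on an open set D. Finite dimension is needed for
   directional derivatives to capture the iterated Frechet derivatives. *)
Fixpoint Ck (R : realType) (V W : normedModType R) (k : nat) (D : set V)
    (f : V -> W) : Prop :=
  match k with
  | 0 => forall a, D a -> {for a, continuous f}
  | k'.+1 => (forall a, D a -> differentiable f a) /\
             (forall v : V, Ck k' D (fun a => 'D_v f a))
  end.

Definition smooth_on (R : realType) (V W : normedModType R) (D : set V)
    (f : V -> W) : Prop := forall k, Ck k D f.

(* Smoothness on a possibly non-open set: local smooth extensions exist. *)
Definition smooth_on_subset (R : realType) (V W : normedModType R) (A : set V)
    (f : V -> W) : Prop :=
  forall p, A p -> exists (O : set V) (F : V -> W),
    [/\ open O, O p, smooth_on O F & forall q, (O `&` A) q -> F q = f q].

Definition regular_surface (R : realType) (S : set (E13 R)) : Prop :=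
  forall p, S p ->
  exists (O : set (E13 R)) (U : set 'rV[R]_2)
         (r : 'rV[R]_2 -> E13 R) (rinv : E13 R -> 'rV[R]_2),
    [/\ open O, O p & open U] /\
    [/\ smooth_on U r,
        set_bij U (O `&` S) r,
        (forall u, U u -> rinv (r u) = u),
        {within O `&` S, continuous rinv} &
        (forall u, U u -> injective ('d r u))].

(* v is the velocity at p of a smooth curve in S. *)
Definition tangent_vector (R : realType) (S : set (E13 R)) (p v : E13 R)
    : Prop :=
  exists (e : R) (a : R -> E13 R),
    [/\ 0 < e, smooth_on `]- e, e[%classic a,
        (forall t, `]- e, e[%classic t -> S (a t)),
        a 0 = p & a^`() 0 = v].

(* N is the unit normal field orienting S; its values off S are irrelevant. *)
Definition oriented_surface (R : realType) (S : set (E13 R))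
    (N : E13 R -> E13 R) : Prop :=
  [/\ regular_surface S,
      smooth_on_subset S N,
      (forall p, S p -> lunit (N p)) &
      (forall p v, S p -> tangent_vector S p v -> ldot (N p) v = 0)].

Definition spacelike_surface (R : realType) (S : set (E13 R))
    (N : E13 R -> E13 R) : Prop :=
  oriented_surface S N /\ (forall p, S p -> timelike (N p)).

Definition timelike_surface (R : realType) (S : set (E13 R))
    (N : E13 R -> E13 R) : Prop :=
  oriented_surface S N /\ (forall p, S p -> spacelike (N p)).

Definition smooth_curve (R : realType) (I : set R) (x : R -> E13 R) : Prop :=
  [/\ open I, is_interval I & smooth_on I x].

Definition curve_on (R : realType) (S : set (E13 R)) (I : set R)
    (x : R -> E13 R) : Prop :=
  smooth_curve I x /\ (forall s, I s -> S (x s)).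

Definition frameT (R : realType) (x : R -> E13 R) : R -> E13 R := x^`().

Definition arclength_param (R : realType) (I : set R) (x : R -> E13 R) : Prop :=
  forall s, I s -> lunit (frameT x s).

Definition spacelike_curve (R : realType) (I : set R) (x : R -> E13 R) : Prop :=
  forall s, I s -> spacelike (frameT x s).

Definition framen (R : realType) (N : E13 R -> E13 R) (x : R -> E13 R)
    : R -> E13 R := fun s => N (x s).

Definition frameg (R : realType) (N : E13 R -> E13 R) (x : R -> E13 R)
    : R -> E13 R := fun s => lcross (framen N x s) (frameT x s).

(* kg, kn, tg are the geodesic curvature, the normal curvature and the geodesic
   torsion of a spacelike curve on a spacelike surface. *)
Definition darboux_spacelike (R : realType) (N : E13 R -> E13 R) (I : set R)
    (x : R -> E13 R) (kg kn tg : R -> R) : Prop :=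
  let T := frameT x in let g := frameg N x in let n := framen N x in
  forall s, I s ->
  [/\ T^`() s = kg s *: g s + kn s *: n s,
      g^`() s = - kg s *: T s + tg s *: n s &
      n^`() s = kn s *: T s + tg s *: g s].

(* Same invariants for a spacelike curve on a timelike surface. *)
Definition darboux_timelike (R : realType) (N : E13 R -> E13 R) (I : set R)
    (x : R -> E13 R) (kg kn tg : R -> R) : Prop :=
  let T := frameT x in let g := frameg N x in let n := framen N x in
  forall s, I s ->
  [/\ T^`() s = kg s *: g s - kn s *: n s,
      g^`() s = kg s *: T s + tg s *: n s &
      n^`() s = kn s *: T s + tg s *: g s].

(* sigma is the correspondence s = s(s_1). *)
Definition mannheim_D_pair (R : realType)
    (N : E13 R -> E13 R) (I : set R) (x : R -> E13 R)
    (N1 : E13 R -> E13 R) (J : set R) (x1 : R -> E13 R)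
    (sigma : R -> R) (lambda : R) : Prop :=
  [/\ smooth_on J sigma,
      (forall s1, J s1 -> sigma^`() s1 != 0),
      set_bij J I sigma,
      lambda != 0 &
      forall s1, J s1 ->
        frameg N x (sigma s1) = framen N1 x1 s1 /\
        x (sigma s1) = x1 s1 + lambda *: framen N1 x1 s1].

Definition type1 (R : realType)
    (S : set (E13 R)) (N : E13 R -> E13 R) (I : set R) (x : R -> E13 R)
    (S1 : set (E13 R)) (N1 : E13 R -> E13 R) (J : set R) (x1 : R -> E13 R)
    : Prop :=
  [/\ spacelike_surface S N, curve_on S I x, spacelike_curve I x &
      arclength_param I x] /\
  [/\ timelike_surface S1 N1, curve_on S1 J x1, spacelike_curve J x1 &
      arclength_param J x1].

(* Main.v *)
Require Import Defs.
From mathcomp Require Import all_boot all_order all_algebra.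
From mathcomp Require Import ring.
From mathcomp Require Import all_classical all_reals all_analysis.
Import Order.TTheory GRing.Theory Num.Theory.
Import numFieldNormedType.Exports.
Local Open Scope ring_scope.
Local Open Scope classical_set_scope.

(* With sigma the correspondence s = s(s_1), differentiating x_1 = x - lambda g
   along sigma gives T_1 = a T - b n, where a = sigma' (1 + lambda k_g) and
   b = lambda sigma' tau_g; then g_1 = g x T_1 = a n - b T and a^2 - b^2 = 1.
   Since a = <T_1, T> and b = <T_1, n>, the product rule and the Darboux
   equations give <T_1', T> and <T_1', n>, and k_{g_1} = - <T_1', g_1> becomes
     k_{g_1} = b a' - a b' + sigma' k_n (a^2 - b^2).
   Only the first derivative of n is needed: k_g and tau_g are differentiable
   along sigma because they are read off a and b, sigma' and lambda being
   nonzero. *)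

Set Implicit Arguments.
Unset Strict Implicit.
Unset Printing Implicit Defensive.

(** * Differentiation of the metric, the vector product and reparametrised curves *)

Lemma is_derive_coord (R : realType) (V : normedModType R) (m n : nat)
    (f : V -> 'M[R]_(m, n)) (t v : V) (df : 'M[R]_(m, n)) i j :
  is_derive t v f df -> is_derive t v (fun y => f y i j) (df i j).
Proof.
move=> [fD <-]; apply: DeriveDef; first exact: (derivable_mxP f t v).1.
by rewrite derive_mx// mxE.
Qed.

Lemma is_derive_ldot (R : realType) (V : normedModType R)
    (f g : V -> E13 R) (t v : V) (df dg : E13 R) :
  is_derive t v f df -> is_derive t v g dg ->
  is_derive t v (fun y => ldot (f y) (g y)) (ldot df (g t) + ldot (f t) dg).
Proof.
move=> fD gD; rewrite /ldot.
have fi i := is_derive_coord 0 i fD; have gi i := is_derive_coord 0 i gD.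
apply: (@is_derive_eq _ _ _ _ _ _ _ _
  (is_deriveD (is_deriveD (is_deriveN (is_deriveM (fi 0) (gi 0)))
                          (is_deriveM (fi 1) (gi 1)))
              (is_deriveM (fi 2) (gi 2)))).
by rewrite /GRing.scale/=; ring.
Qed.

Lemma lcrossE (R : realType) (u v : E13 R) :
  (lcross u v 0 0 = u 0 1 * v 0 2 - u 0 2 * v 0 1) *
  (lcross u v 0 1 = u 0 0 * v 0 2 - u 0 2 * v 0 0) *
  (lcross u v 0 2 = u 0 1 * v 0 0 - u 0 0 * v 0 1).
Proof. by rewrite !mxE. Qed.

Lemma E13_eqP (R : realType) (u v : E13 R) :
  u 0 0 = v 0 0 -> u 0 1 = v 0 1 -> u 0 2 = v 0 2 -> u = v.
Proof.
move=> e0 e1 e2; apply/rowP => -[[|[|[|//]]] i].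
- by rewrite (_ : Ordinal i = 0)//; exact: val_inj.
- by rewrite (_ : Ordinal i = 1)//; exact: val_inj.
- by rewrite (_ : Ordinal i = 2)//; exact: val_inj.
Qed.

(** Each coordinate is a difference of products of coordinates. No value of the derivative is
    recorded: for [frameg] it comes from the Darboux equations. *)
Lemma derivable_lcross (R : realType) (V : normedModType R)
    (f g : V -> E13 R) (t v : V) :
  derivable f t v -> derivable g t v ->
  derivable (fun y => lcross (f y) (g y)) t v.
Proof.
move=> fD gD; apply/derivable_mxP => i j; rewrite ord1.
have fi k := (derivable_mxP f t v).1 fD 0 k.
have gi k := (derivable_mxP g t v).1 gD 0 k.
case: j => [[|[|[|//]]] j].
- rewrite (_ : (fun y => _) = (fun y => f y 0 1) * (fun y => g y 0 2)
    - (fun y => f y 0 2) * (fun y => g y 0 1)).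
    by apply: derivableB; apply: derivableM.
  by apply/funext => y; rewrite mxE.
- rewrite (_ : (fun y => _) = (fun y => f y 0 0) * (fun y => g y 0 2)
    - (fun y => f y 0 2) * (fun y => g y 0 0)).
    by apply: derivableB; apply: derivableM.
  by apply/funext => y; rewrite mxE.
- rewrite (_ : (fun y => _) = (fun y => f y 0 1) * (fun y => g y 0 0)
    - (fun y => f y 0 0) * (fun y => g y 0 1)).
    by apply: derivableB; apply: derivableM.
  by apply/funext => y; rewrite mxE.
Qed.

Lemma is_derive_comp_curve (R : realType) (V : normedModType R) (f : R -> V)
    (h : R -> R) (t dh : R) (df : V) :
  is_derive t 1 h dh -> is_derive (h t) 1 f df ->
  is_derive t 1 (f \o h) (dh *: df).
Proof.
move=> [/derivable1_diffP hD <-] [/derivable1_diffP fD <-].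
have fhD := differentiable_comp hD fD.
apply: DeriveDef; first exact/derivable1_diffP.
rewrite -derive1E derive1E'// diff_comp//= -derive1E derive1E'//.
(* The differential of [f] is linear, so the scalar [h'] comes out of it. *)
by rewrite -derive1E derive1E'// -linearZ/= [_ *: 1]mulr1.
Qed.

(** * Algebra of the Lorentzian metric and vector product *)

Lemma ldotC (R : realType) (u v : E13 R) : ldot u v = ldot v u.
Proof. by rewrite /ldot; ring. Qed.

Lemma ldotDr (R : realType) (u v w : E13 R) :
  ldot u (v + w) = ldot u v + ldot u w.
Proof. by rewrite /ldot !mxE; ring. Qed.

Lemma ldotZr (R : realType) (k : R) (u v : E13 R) :
  ldot u (k *: v) = k * ldot u v.
Proof. by rewrite /ldot !mxE; ring. Qed.

Lemma ldotDl (R : realType) (u v w : E13 R) :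
  ldot (u + v) w = ldot u w + ldot v w.
Proof. by rewrite /ldot !mxE; ring. Qed.

Lemma ldotZl (R : realType) (k : R) (u v : E13 R) :
  ldot (k *: u) v = k * ldot u v.
Proof. by rewrite /ldot !mxE; ring. Qed.

Lemma ldotNl (R : realType) (u v : E13 R) : ldot (- u) v = - ldot u v.
Proof. by rewrite -scaleN1r ldotZl mulN1r. Qed.

Lemma lcrossDr (R : realType) (u v w : E13 R) :
  lcross u (v + w) = lcross u v + lcross u w.
Proof. by apply: E13_eqP; rewrite !(mxE, lcrossE) /=; ring. Qed.

Lemma lcrossZr (R : realType) (k : R) (u v : E13 R) :
  lcross u (k *: v) = k *: lcross u v.
Proof. by apply: E13_eqP; rewrite !(mxE, lcrossE) /=; ring. Qed.

(** With [u = n], [v = T] and [g = n x T], this and the next identity give [g x T = n] and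
    [g x n = T], which turn [T_1 = a T - b n] into [g_1 = a n - b T]. *)
Lemma lcross_lcrossr (R : realType) (u v : E13 R) :
  lcross (lcross u v) v = ldot v v *: u - ldot u v *: v.
Proof. by apply: E13_eqP; rewrite !(mxE, lcrossE) /= /ldot; ring. Qed.

Lemma lcross_lcrossl (R : realType) (u v : E13 R) :
  lcross (lcross u v) u = ldot u v *: u - ldot u u *: v.
Proof. by apply: E13_eqP; rewrite !(mxE, lcrossE) /= /ldot; ring. Qed.

Lemma ldot_lcrossl (R : realType) (u v : E13 R) : ldot u (lcross u v) = 0.
Proof. by rewrite /ldot !lcrossE; ring. Qed.

Lemma ldot_lcrossr (R : realType) (u v : E13 R) : ldot v (lcross u v) = 0.
Proof. by rewrite /ldot !lcrossE; ring. Qed.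

(** The zero vector counts as spacelike; the unit condition rules it out. *)
Lemma lunit_spacelike (R : realType) (u : E13 R) :
  lunit u -> spacelike u -> ldot u u = 1.
Proof.
rewrite /lunit => uu [u0|u0]; first by rewrite -uu gtr0_norm.
move: uu; rewrite u0.
have -> : ldot (0 : E13 R) 0 = 0 by rewrite /ldot !mxE; ring.
by rewrite normr0 => /esym/eqP; rewrite oner_eq0.
Qed.

Lemma lunit_timelike (R : realType) (u : E13 R) :
  lunit u -> timelike u -> ldot u u = -1.
Proof.
rewrite /lunit /timelike => + u0.
by rewrite ltr0_norm// => <-; rewrite opprK.
Qed.

(** * Smoothness classes and differentiability of the frame fields *)

Lemma Ck_subset (R : realType) (V W : normedModType R) k (D E : set V)
    (f : V -> W) : E `<=` D -> Ck k D f -> Ck k E f.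
Proof.
move=> ED; elim: k f => [|k IH] f /=; first by move=> fD a /ED; exact: fD.
by move=> [fD fk]; split=> [a /ED|v]; [exact: fD|exact/IH/fk].
Qed.

(** Directional derivatives commute with translations. This serves to recentre a curve at parameter
    0, as [tangent_vector] requires. *)
Lemma Ck_shift (R : realType) (V W : normedModType R) k (D : set V) (c : V)
    (f : V -> W) :
  Ck k D f -> Ck k [set a | D (a + c)] (fun a => f (a + c)).
Proof.
elim: k f => [|k IH] f /=.
  move=> fD a /fD fc.
  apply: (@continuous_comp _ _ _ (shift c) f) => //.
  by apply: cvgD; [exact: cvg_id|exact: cvg_cst].
move=> [fD fk]; split=> [a /fD fa|v].
  have sD : differentiable (shift c) a by exact: differentiableD.
  exact: (differentiable_comp sD fa).
rewrite (_ : (fun a => _) = (fun a => 'D_v f (a + c))); last first.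
  apply/funext => a; apply: (congr1 (fun g : R -> W => lim (g @ 0^'))).
  by apply/funext => h /=; rewrite addrA.
exact: (IH ('D_v f) (fk v)).
Qed.

Lemma smooth_on_differentiable (R : realType) (V W : normedModType R)
    (D : set V) (f : V -> W) (a : V) :
  smooth_on D f -> D a -> differentiable f a.
Proof. by move=> /(_ 1%N)[+ _]; exact. Qed.

Lemma smooth_on_derive1 (R : realType) (W : normedModType R)
    (D : set R) (f : R -> W) : smooth_on D f -> smooth_on D f^`().
Proof.
move=> fD k; rewrite (_ : f^`() = fun a => 'D_1 f a); first exact: (fD k.+1).2.
by apply/funext => a; rewrite derive1E.
Qed.

Lemma smooth_curve_is_derive (R : realType) (I : set R) (x : R -> E13 R) s :
  smooth_curve I x -> I s -> is_derive s 1 x (frameT x s).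
Proof.
move=> [_ _ xI] Is; rewrite /frameT derive1E; apply/derivableP/derivable1_diffP.
exact: smooth_on_differentiable xI Is.
Qed.

Lemma frameT_is_derive (R : realType) (I : set R) (x : R -> E13 R) s :
  smooth_curve I x -> I s -> is_derive s 1 (frameT x) ((frameT x)^`() s).
Proof.
move=> [_ _ xI] Is; rewrite derive1E; apply/derivableP/derivable1_diffP.
exact: smooth_on_differentiable (smooth_on_derive1 xI) Is.
Qed.

Lemma frameT_tangent (R : realType) (S : set (E13 R)) (I : set R)
    (x : R -> E13 R) s :
  curve_on S I x -> I s -> tangent_vector S (x s) (frameT x s).
Proof.
move=> [xI xS] Is; have [oI _ xsm] := xI.
have [e /= e0 eI] : nbhs_ball s I by apply/nbhs_ballP; exact: open_nbhs_nbhs.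
(* [e] is the radius of a ball around [s] inside the open set [I], so the curve shifted by [s] is
   defined on the whole symmetric interval. *)
have shI : `]- e, e[%classic `<=` [set a | I (a + s)].
  move=> t /=; rewrite in_itv/= -ltr_norml => te; apply: eI.
  by rewrite /ball/= opprD addrCA subrr addr0 normrN.
exists e, (fun t => x (t + s)); split => //.
- by move=> k; apply: Ck_subset shI _; exact: Ck_shift.
- by move=> t /shI /=; exact: xS.
- by rewrite add0r.
- rewrite /frameT; apply: (congr1 (fun g : R -> E13 R => lim (g @ 0^'))).
  by apply/funext => h /=; rewrite addr0 add0r.
Qed.

(** [N] is smooth on [S] only through local extensions [F]. By continuity [x] stays in the domain of
    [F] near [s], and it runs on [S], so [N] and [F] agree along [x] there and the chain rule
    applies to [F]. *)
Lemma framen_is_derive (R : realType) (S : set (E13 R)) (N : E13 R -> E13 R)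
    (I : set R) (x : R -> E13 R) s :
  oriented_surface S N -> curve_on S I x -> I s ->
  is_derive s 1 (framen N x) ((framen N x)^`() s).
Proof.
move=> [_ Nsm _ _] [xI xS] Is; have [oI _ xsm] := xI.
have [D [F [oD Dx Fsm FN]]] := Nsm _ (xS _ Is).
have xD := smooth_on_differentiable xsm Is.
have FD := smooth_on_differentiable Fsm Dx.
rewrite derive1E; apply: derivableP.
apply: (@near_eq_derivable _ _ _ (F \o x)); last first.
  by apply/derivable1_diffP; exact: differentiable_comp.
have nO : \forall y \near s, D (x y).
  exact: (differentiable_continuous xD) (open_nbhs_nbhs (conj oD Dx)).
have nI : \forall y \near s, I y := open_nbhs_nbhs (conj oI Is).
near=> y; rewrite /= /framen; apply: FN; split; first by near: y.
by apply: xS; near: y.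
Unshelve. all: by end_near. Qed.

Lemma frameg_is_derive (R : realType) (S : set (E13 R)) (N : E13 R -> E13 R)
    (I : set R) (x : R -> E13 R) s :
  oriented_surface S N -> curve_on S I x -> I s ->
  is_derive s 1 (frameg N x) ((frameg N x)^`() s).
Proof.
move=> SN xS Is; rewrite derive1E; apply: derivableP; apply: derivable_lcross.
  by have [] := framen_is_derive SN xS Is.
by have [] := frameT_is_derive xS.1 Is.
Qed.

(** * Tangent and geodesic curvature of the partner curve *)

Lemma mannheim_frameT1 (R : realType)
    (S : set (E13 R)) (N : E13 R -> E13 R) (I : set R) (x : R -> E13 R)
    (N1 : E13 R -> E13 R) (J : set R) (x1 : R -> E13 R)
    (sigma : R -> R) (lambda : R) (kg kn tg : R -> R) s1 :
  oriented_surface S N -> curve_on S I x -> open J ->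
  mannheim_D_pair N I x N1 J x1 sigma lambda ->
  darboux_spacelike N I x kg kn tg -> J s1 ->
  frameT x1 s1 =
    (derive1 sigma s1 * (1 + lambda * kg (sigma s1))) *: frameT x (sigma s1)
    - (lambda * (derive1 sigma s1 * tg (sigma s1))) *: framen N x (sigma s1).
Proof.
move=> SN xS oJ [sigmaJ _ [sJI _ _] _ pair] Hx Js.
have Is : I (sigma s1) by exact: sJI.
have sD : is_derive s1 1 sigma (derive1 sigma s1).
  rewrite derive1E; apply/derivableP/derivable1_diffP.
  exact: smooth_on_differentiable sigmaJ Js.
have xD := is_derive_comp_curve sD (smooth_curve_is_derive xS.1 Is).
have gD := is_derive_comp_curve sD (frameg_is_derive SN xS Is).
have x1D := is_deriveB xD (is_deriveZ lambda gD).
(* The relation between the two curves holds only on [J]; as [J] is open, it holds near [s1], which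
   suffices for differentiating. *)
have /near_eq_derive E : \forall y \near s1,
    x1 y = (x \o sigma - lambda \*: (frameg N x \o sigma)) y.
  have nJ : \forall y \near s1, J y := open_nbhs_nbhs (conj oJ Js).
  near=> y; have [|gn1 xE] := pair y; first by near: y.
  by rewrite /= !fctE/= xE gn1 addrK.
rewrite {1}/frameT derive1E E derive_val.
have [_ -> _] := Hx _ Is.
apply/rowP => i; rewrite !mxE; ring.
Unshelve. all: by end_near. Qed.

(** General formula, with no restriction on [kg], [kn], [tg], from which all three cases follow by
    specialisation. *)
Lemma mannheim_kg1 (R : realType)
    (S : set (E13 R)) (N : E13 R -> E13 R) (I : set R) (x : R -> E13 R)
    (S1 : set (E13 R)) (N1 : E13 R -> E13 R) (J : set R) (x1 : R -> E13 R)
    (sigma : R -> R) (lambda : R) (kg kn tg kg1 kn1 tg1 : R -> R) s1 :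
  type1 S N I x S1 N1 J x1 ->
  mannheim_D_pair N I x N1 J x1 sigma lambda ->
  darboux_spacelike N I x kg kn tg ->
  darboux_timelike N1 J x1 kg1 kn1 tg1 -> J s1 ->
  kg1 s1 = (- lambda * derive1 (tg \o sigma) s1 * (1 + lambda * kg (sigma s1))
            + lambda ^+ 2 * tg (sigma s1) * derive1 (kg \o sigma) s1)
             * derive1 sigma s1 ^+ 2
           + kn (sigma s1) * ((1 + lambda * kg (sigma s1)) ^+ 2
                              - lambda ^+ 2 * tg (sigma s1) ^+ 2)
             * derive1 sigma s1 ^+ 3.
Proof.
move=> [[[SN Nt] xS xsp xal] [_ x1S x1sp x1al]] pair Hx Hx1 Js.
have [_ _ NS NT] := SN.
have [[oJ _ _] _] := x1S.
have [sigmaJ s'0 [sJI _ _] l0 gn1] := pair.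
have dots s : I s -> [/\ ldot (frameT x s) (frameT x s) = 1,
    ldot (framen N x s) (framen N x s) = -1 &
    ldot (framen N x s) (frameT x s) = 0].
  move=> Is; have Sx := xS.2 _ Is; split.
  - by apply: lunit_spacelike; [exact: xal|exact: xsp].
  - by apply: lunit_timelike; [exact: NS|exact: Nt].
  - by apply: NT => //; exact: frameT_tangent xS Is.
have nJ : \forall y \near s1, J y := open_nbhs_nbhs (conj oJ Js).
have Is : I (sigma s1) by exact: sJI.
have T1E y := @mannheim_frameT1 _ _ _ _ _ _ _ _ _ _ _ _ _ y SN xS oJ pair Hx.
have sD : is_derive s1 1 sigma (derive1 sigma s1).
  rewrite derive1E; apply/derivableP/derivable1_diffP.
  exact: smooth_on_differentiable sigmaJ Js.
have s'D : is_derive s1 1 (derive1 sigma) (derive1 (derive1 sigma) s1).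
  rewrite [X in is_derive _ _ _ X]derive1E; apply/derivableP/derivable1_diffP.
  exact: smooth_on_differentiable (smooth_on_derive1 sigmaJ) Js.
have TD := is_derive_comp_curve sD (frameT_is_derive xS.1 Is).
have nD := is_derive_comp_curve sD (framen_is_derive SN xS Is).
have T1D := frameT_is_derive x1S.1 Js.
have aD := is_derive_ldot T1D TD.
have bD := is_derive_ldot T1D nD.
(* Taken as scalar products of differentiable fields, [a] and [b] are known to be differentiable
   before anything is known about [kg] and [tg]. *)
set a := fun y => ldot (frameT x1 y) ((frameT x \o sigma) y) in aD.
set b := fun y => ldot (frameT x1 y) ((framen N x \o sigma) y) in bD.
have aE y : J y -> a y = derive1 sigma y * (1 + lambda * kg (sigma y)).
  move=> Jy; have [TT nn nT] := dots _ (sJI _ Jy).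
  by rewrite /a/= T1E// ldotDl ldotNl !ldotZl TT nT; ring.
have bE y : J y -> b y = lambda * (derive1 sigma y * tg (sigma y)).
  move=> Jy; have [TT nn nT] := dots _ (sJI _ Jy).
  by rewrite /b/= T1E// ldotDl ldotNl !ldotZl nn ldotC nT; ring.
have s'V : derivable (fun y => (derive1 sigma y)^-1) s1 1.
  by apply: derivableV; [exact: s'0|case: s'D].
(* Solve [a = sigma' (1 + lambda kg)] for [kg]: near [s1] it is [(a / sigma' - 1) / lambda], a
   differentiable expression. Likewise [tg] is [b / (lambda sigma')]. *)
have kgD : is_derive s1 1 (kg \o sigma) (derive1 (kg \o sigma) s1).
  rewrite derive1E; apply: derivableP.
  apply: (@near_eq_derivable _ _ _
    (lambda^-1 \*: (a * (fun y => (derive1 sigma y)^-1) - cst 1))).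
    near=> y; have Jy : J y by near: y.
    rewrite /= !fctE aE// mulrAC mulfV ?s'0// /GRing.scale/=; field.
    exact: l0.
  apply: derivableZ; apply: derivableB => //; apply: derivableM => //.
have tgD : is_derive s1 1 (tg \o sigma) (derive1 (tg \o sigma) s1).
  rewrite derive1E; apply: derivableP.
  apply: (@near_eq_derivable _ _ _
    (lambda^-1 \*: (b * (fun y => (derive1 sigma y)^-1)))).
    near=> y; have Jy : J y by near: y.
    rewrite /= !fctE bE// /GRing.scale/=; field.
    by rewrite l0 s'0.
  by apply: derivableZ; apply: derivableM => //; case: bD.
have kD := is_deriveD (is_derive_cst (1 : R) s1 1) (is_deriveZ lambda kgD).
have a'E := is_deriveM s'D kD.
have b'E := is_deriveZ lambda (is_deriveM s'D tgD).
have aN : \forall y \near s1,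
    (derive1 sigma * (cst 1 + lambda \*: (kg \o sigma))) y = a y.
  by near=> y; rewrite aE//; near: y.
have bN : \forall y \near s1,
    (lambda \*: (derive1 sigma * (tg \o sigma))) y = b y.
  by near=> y; rewrite bE//; near: y.
have [_ a'] := near_eq_is_derive aN a'E.
have [_ b'] := near_eq_is_derive bN b'E.
(* The derivatives of [a] and [b] are now known in two ways, from the closed forms and from the
   product rule; [aD] and [bD] equate the two. *)
have [_] := aD; rewrite a' => {a'} {}aD.
have [_] := bD; rewrite b' => {b'} {}bD.
have [TT nn nT] := dots _ Is.
have [T'E _ n'E] := Hx _ Is.
have [T1'E _ _] := Hx1 _ Js.
have T1ab : frameT x1 s1 = a s1 *: frameT x (sigma s1)
    + (- b s1) *: framen N x (sigma s1).
  by rewrite T1E// aE// bE// scaleNr.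
have g1E : frameg N1 x1 s1 = a s1 *: framen N x (sigma s1)
    - b s1 *: frameT x (sigma s1).
  rewrite /frameg -(gn1 _ Js).1 T1ab lcrossDr !lcrossZr.
  by rewrite lcross_lcrossr lcross_lcrossl TT nn nT !scale0r; apply/rowP => i;
    rewrite !mxE; ring.
have T1T1 : ldot (frameT x1 s1) (frameT x1 s1) = 1.
  by apply: lunit_spacelike; [exact: x1al|exact: x1sp].
have gT : ldot (frameg N x (sigma s1)) (frameT x (sigma s1)) = 0.
  by rewrite ldotC ldot_lcrossr.
have gn : ldot (frameg N x (sigma s1)) (framen N x (sigma s1)) = 0.
  by rewrite ldotC ldot_lcrossl.
have ab1 : a s1 ^+ 2 - b s1 ^+ 2 = 1.
  rewrite -T1T1 T1ab !(ldotDl, ldotDr, ldotZl, ldotZr) TT nn nT.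
  by rewrite [ldot (frameT _ _) _]ldotC nT; ring.
(* [T_1] is orthogonal to [g], which removes the [kg] term of [T'] and the [tg] term of [n'] from
   the product rule. *)
have T1g : ldot (frameT x1 s1) (frameg N x (sigma s1)) = 0.
  by rewrite T1ab ldotC !(ldotDr, ldotZr) gT gn; ring.
(* Here [n_1 = g] is orthogonal to [T] and [n], so [kn1] drops out and only the [g_1] component of
   [T_1'] contributes. *)
have T1'T : ldot (derive1 (frameT x1) s1) (frameT x (sigma s1)) = - (kg1 s1 * b s1).
  rewrite T1'E -(gn1 _ Js).1 g1E !(ldotDl, ldotNl, ldotZl) TT nT gT; ring.
have T1'n : ldot (derive1 (frameT x1) s1) (framen N x (sigma s1)) = - (kg1 s1 * a s1).
  by rewrite T1'E -(gn1 _ Js).1 g1E !(ldotDl, ldotNl, ldotZl) nn gn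
    [ldot (frameT _ _) _]ldotC nT; ring.
move: aD bD; rewrite /= T1'T T1'n T'E n'E !(ldotDr, ldotZr) T1g.
rewrite -/(a s1) -/(b s1) /GRing.scale/= !fctE !mulr0 !add0r addr0 => aD bD.
(* [kg1] is multiplied by [a^2 - b^2 = 1] and arranged so that the two parentheses after [b] and [a]
   are the product rule values of [a'] and [b']. *)
have -> : kg1 s1 = derive1 sigma s1 * kn (sigma s1) * (a s1 ^+ 2 - b s1 ^+ 2)
    + b s1 * (- (kg1 s1 * b s1) + derive1 sigma s1 * (kn (sigma s1) * b s1))
    - a s1 * (- (kg1 s1 * a s1) + derive1 sigma s1 * (kn (sigma s1) * a s1)).
  by rewrite -[LHS]mulr1 -ab1; ring.
(* With the closed forms inserted, the second derivative of [sigma] cancels in [b a' - a b']. *)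
rewrite -aD -bD aE// bE//= [lambda *: kg _]mulrC; ring.
Unshelve. all: by end_near. Qed.

Theorem corollary4p1 (R : realType)
    (S : set (E13 R)) (N : E13 R -> E13 R) (I : set R) (x : R -> E13 R)
    (S1 : set (E13 R)) (N1 : E13 R -> E13 R) (J : set R) (x1 : R -> E13 R)
    (sigma : R -> R) (lambda : R)
    (kg kn tg kg1 kn1 tg1 : R -> R)
    (Htype : type1 S N I x S1 N1 J x1)
    (Hpair : mannheim_D_pair N I x N1 J x1 sigma lambda)
    (Hx : darboux_spacelike N I x kg kn tg)
    (Hx1 : darboux_timelike N1 J x1 kg1 kn1 tg1) :
  [/\ (forall s, I s -> kg s = 0) ->
      forall s1, J s1 ->
        kg1 s1 = kn (sigma s1) * (1 - lambda ^+ 2 * tg (sigma s1) ^+ 2)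
                   * derive1 sigma s1 ^+ 3
                 - lambda * derive1 (tg \o sigma) s1 * derive1 sigma s1 ^+ 2,
      (forall s, I s -> kn s = 0) ->
      forall s1, J s1 ->
        kg1 s1 = (- lambda * derive1 (tg \o sigma) s1 * (1 + lambda * kg (sigma s1))
                  + lambda ^+ 2 * tg (sigma s1) * derive1 (kg \o sigma) s1)
                 * derive1 sigma s1 ^+ 2 &
      (forall s, I s -> tg s = 0) ->
      forall s1, J s1 ->
        kg1 s1 = kn (sigma s1) * (1 + lambda * kg (sigma s1)) ^+ 2
                 * derive1 sigma s1 ^+ 3].
Proof.
have kg1E s1 :=
  @mannheim_kg1 _ _ _ _ _ _ _ _ _ _ _ _ _ _ _ _ _ s1 Htype Hpair Hx Hx1.
have oJ : open J by have [_ [_ [[]]]] := Htype.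
have sJI : set_fun J I sigma by have [_ _ []] := Hpair.
(* [f] vanishes only on [I], but [sigma] maps the open set [J] into [I], so [f \o sigma] is zero
   near [s1]. This kills the derivative of [kg] in case (i) and that of [tg] in case (iii). *)
have derive0 (f : R -> R) s1 : (forall s, I s -> f s = 0) -> J s1 ->
    derive1 (f \o sigma) s1 = 0.
  move=> f0 Js; rewrite derive1E (@near_eq_derive _ _ _ _ (cst 0)) ?derive_cst//.
  have nJ : \forall y \near s1, J y := open_nbhs_nbhs (conj oJ Js).
  by near=> y; apply/f0/sJI; near: y.
split=> z s1 Js; rewrite kg1E//.
- by rewrite (derive0 kg)// z; [ring|exact: sJI].
- by rewrite z; [ring|exact: sJI].
- by rewrite (derive0 tg)// z; [ring|exact: sJI].
Unshelve. all: by end_near. Qed.
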